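(* Let $\alpha\in\mathbb{Q}(i,\sqrt3)$ be an ambiguous number. Then the orbit $\Gamma\alpha$ of $\alpha$ under the Picard group $\Gamma=PSL(2,\mathbb{Z}[i])$ contains only finitely many ambiguous numbers.
   Context: The Picard group $\Gamma=PSL(2,\mathbb{Z}[i])$ acts on $\mathbb{Q}(i,\sqrt3)\cup\{\infty\}$ by linear fractional transformations $z\mapsto\frac{pz+q}{rz+s}$ with $p,q,r,s\in\mathbb{Z}[i]$, $ps-qr=1$. An ambiguous number is a real quadratic irrational number $\alpha=\frac{a+b\sqrt3}{c}\in\mathbb{Q}(i,\sqrt3)$ with $a,b,c\in\mathbb{Z}$, $c\neq0$, such that $\alpha$ and its conjugate $\bar\alpha=\frac{a-b\sqrt3}{c}$ have opposite signs. *)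

(* Defs.v *)
From HB Require Import structures.
From mathcomp Require Import all_boot all_order all_algebra all_field.
From mathcomp Require Import boolp classical_sets cardinality.
From mathcomp Require Import ring.

Set Implicit Arguments.
Unset Strict Implicit.
Unset Printing Implicit Defensive.

Import Order.TTheory GRing.Theory Num.Theory.
Local Open Scope ring_scope.

(* [num_field_exists s] provides the number field generated by s over rat,    *)
(* an embedding of it into algC, and the preimages of the generators.         *)
Definition Qi3_exists := num_field_exists [:: 'i; sqrtC 3].

Definition Qi3 : fieldExtType rat := projT1 Qi3_exists.

Definition Qi3toC : {rmorphism Qi3 -> algC} := projT1 (projT2 Qi3_exists).

Definition Qi3_gens : seq Qi3 := s2val (projT2 (projT2 Qi3_exists)).

Definition im : Qi3 := Qi3_gens`_0.
Definition sqrt3 : Qi3 := Qi3_gens`_1.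

Lemma Qi3_gensE : Qi3_gens = [:: im; sqrt3].
Proof.
rewrite /im /sqrt3; have := s2valP (projT2 (projT2 Qi3_exists)).
by rewrite -/Qi3_gens; case: Qi3_gens => [|x [|y []]].
Qed.

Lemma Qi3_generated : <<1 & [:: im; sqrt3]>>%VS = fullv.
Proof. by rewrite -Qi3_gensE; apply: s2valP' (projT2 (projT2 Qi3_exists)). Qed.

Lemma Qi3toC_im : Qi3toC im = 'i.
Proof.
have := s2valP (projT2 (projT2 Qi3_exists)).
by rewrite -/Qi3_gens Qi3_gensE => -[].
Qed.

Lemma Qi3toC_sqrt3 : Qi3toC sqrt3 = sqrtC 3.
Proof.
have := s2valP (projT2 (projT2 Qi3_exists)).
by rewrite -/Qi3_gens Qi3_gensE => -[].
Qed.

(* The ring Z[i]; see gaussIntP.                                              *)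
Definition gaussInt : {pred Qi3} :=
  [pred z | ('Re (Qi3toC z) \in Num.int) && ('Im (Qi3toC z) \in Num.int)].

Lemma gaussIntP (z : Qi3) :
  reflect (exists m n : int, z = m%:~R + n%:~R * im) (z \in gaussInt).
Proof.
apply: (iffP andP) => [[/intrP[m Dm] /intrP[n Dn]] | [m [n ->]]].
  exists m, n; apply: (fmorph_inj Qi3toC).
  rewrite rmorphD rmorphM /= !rmorph_int Qi3toC_im -Dm -Dn mulrC.
  exact: Crect.
rewrite rmorphD rmorphM /= !rmorph_int Qi3toC_im mulrC.
by rewrite Re_rect ?Im_rect ?realz ?intr_int.
Qed.

Lemma gaussInt_subring : subring_closed gaussInt.
Proof.
split=> [|x y /andP[xr xi] /andP[yr yi]|x y /andP[xr xi] /andP[yr yi]].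
- by apply/gaussIntP; exists 1, 0; rewrite mul0r addr0.
- by apply/andP; rewrite rmorphB !raddfB /= !rpredB.
- apply/andP; rewrite rmorphM /= ReM ImM.
  by rewrite rpredB ?rpredD ?rpredM.
Qed.

HB.instance Definition _ :=
  GRing.isSubringClosed.Build Qi3 gaussInt gaussInt_subring.

Definition inSL2 : pred 'M[Qi3]_2 :=
  [pred M | (M \is a mxOver gaussInt) && (\det M == 1)].

Record SL2 := MkSL2 { SL2mx :> 'M[Qi3]_2; _ : inSL2 SL2mx }.

HB.instance Definition _ := [isSub for SL2mx].
HB.instance Definition _ := [Choice of SL2 by <:].

Lemma SL2_one_subproof : inSL2 1%:M.
Proof. by rewrite /inSL2 /= mxOver_scalar ?rpred0 ?rpred1 // det1 eqxx. Qed.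

Lemma SL2_mul_subproof (M N : SL2) : inSL2 (M *m N).
Proof.
have /andP[ZM /eqP dM] := valP M; have /andP[ZN /eqP dN] := valP N.
by rewrite /inSL2 /= mxOverM // det_mulmx dM dN mulr1 eqxx.
Qed.

Lemma SL2_unitmx (M : SL2) : (M : 'M_2) \in unitmx.
Proof. by have /andP[_ /eqP dM] := valP M; rewrite unitmxE dM unitr1. Qed.

Lemma SL2_inv_subproof (M : SL2) : inSL2 (invmx M).
Proof.
have uM := SL2_unitmx M; have /andP[/mxOverP ZM /eqP dM] := valP M.
rewrite /inSL2 /= det_inv /= -[\det _]/(\det (val M)) dM invr1 eqxx andbT.
apply/mxOverP => i j; rewrite /invmx uM dM invr1 scale1r mxE.
rewrite /cofactor rpredMsign; apply: rpred_sum => s _; rewrite rpredMsign.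
by apply: rpred_prod => k _; rewrite !mxE; apply: ZM.
Qed.

Lemma SL2_opp_subproof (M : SL2) : inSL2 (- (M : 'M_2)).
Proof.
have /andP[/mxOverP ZM /eqP dM] := valP M; rewrite /inSL2 /= -scaleN1r detZ dM.
rewrite mulr1 sqrrN expr1n eqxx andbT.
by apply/mxOverP => i j; rewrite mxE mulN1r rpredN; apply: ZM.
Qed.

Definition SL2_one : SL2 := MkSL2 SL2_one_subproof.
Definition SL2_mul (M N : SL2) : SL2 := MkSL2 (SL2_mul_subproof M N).
Definition SL2_inv (M : SL2) : SL2 := MkSL2 (SL2_inv_subproof M).
Definition SL2_opp (M : SL2) : SL2 := MkSL2 (SL2_opp_subproof M).

Fact SL2_mulA : associative SL2_mul.
Proof. by move=> M N P; apply: val_inj; rewrite /= mulmxA. Qed.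
Fact SL2_mul1g : left_id SL2_one SL2_mul.
Proof. by move=> M; apply: val_inj; rewrite /= mul1mx. Qed.
Fact SL2_mulg1 : right_id SL2_one SL2_mul.
Proof. by move=> M; apply: val_inj; rewrite /= mulmx1. Qed.
Fact SL2_mulVg : left_inverse SL2_one SL2_inv SL2_mul.
Proof. by move=> M; apply: val_inj; rewrite /= mulVmx ?SL2_unitmx. Qed.
Fact SL2_mulgV : right_inverse SL2_one SL2_inv SL2_mul.
Proof. by move=> M; apply: val_inj; rewrite /= mulmxV ?SL2_unitmx. Qed.

HB.instance Definition _ := isGroup.Build SL2
  SL2_mulA SL2_mul1g SL2_mulg1 SL2_mulVg SL2_mulgV.

(* The Picard group PSL(2, Z[i]) = SL(2, Z[i]) / {1, -1}.                     *)
Definition eqpm : rel SL2 := [rel M N | (M == N) || (M == SL2_opp N)].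

Lemma SL2_oppK : involutive SL2_opp.
Proof. by move=> M; apply: val_inj; rewrite /= opprK. Qed.

Lemma eqpmP (M N : SL2) : reflect (M = N \/ M = SL2_opp N) (eqpm M N).
Proof.
by apply: (iffP orP) => -[]; [move/eqP|move/eqP|move->|move->]; auto.
Qed.

Fact eqpm_refl : reflexive eqpm.
Proof. by move=> M; rewrite /eqpm /= eqxx. Qed.
Fact eqpm_sym : symmetric eqpm.
Proof.
by move=> M N; apply/eqpmP/eqpmP => -[->|->]; rewrite ?SL2_oppK; auto.
Qed.
Fact eqpm_trans : transitive eqpm.
Proof.
by move=> N M P /eqpmP[->|->] /eqpmP[->|->]; apply/eqpmP;
   rewrite ?SL2_oppK; auto.
Qed.

Canonical eqpm_equiv := EquivRel eqpm eqpm_refl eqpm_sym eqpm_trans.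

Definition Picard := {eq_quot eqpm}%qT.

HB.instance Definition _ := Choice.on Picard.
HB.instance Definition _ := Quotient.on Picard.
HB.instance Definition _ : EqQuotient SL2 eqpm Picard := EqQuotient.on Picard.

Definition Picard_class (M : SL2) : Picard := \pi_Picard%qT M.

Lemma Picard_classP (M N : SL2) :
  reflect (M = N \/ M = SL2_opp N) (Picard_class M == Picard_class N).
Proof. by rewrite /Picard_class eqmodE; apply: eqpmP. Qed.

Lemma Picard_classK (g : Picard) : Picard_class (repr g) = g.
Proof. exact: reprK. Qed.

Lemma repr_class (M : SL2) :
  repr (Picard_class M) = M \/ repr (Picard_class M) = SL2_opp M.
Proof. by apply/Picard_classP; rewrite Picard_classK. Qed.

Definition Picard_one : Picard := Picard_class 1%g.
Definition Picard_mul (g h : Picard) : Picard :=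
  Picard_class (repr g * repr h)%g.
Definition Picard_inv (g : Picard) : Picard := Picard_class (repr g)^-1%g.

Lemma SL2_mulN (M N : SL2) : (M * SL2_opp N = SL2_opp (M * N))%g.
Proof. by apply: val_inj; rewrite /= mulmxN. Qed.
Lemma SL2_mulNg (M N : SL2) : (SL2_opp M * N = SL2_opp (M * N))%g.
Proof. by apply: val_inj; rewrite /= mulNmx. Qed.

Lemma Picard_classN (M : SL2) : Picard_class (SL2_opp M) = Picard_class M.
Proof. by apply/eqP/Picard_classP; right. Qed.

Lemma Picard_classM (M N : SL2) :
  Picard_mul (Picard_class M) (Picard_class N) = Picard_class (M * N)%g.
Proof.
rewrite /Picard_mul.
by case: (repr_class M) => ->; case: (repr_class N) => ->;
   rewrite ?SL2_mulN ?SL2_mulNg ?Picard_classN // SL2_oppK.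
Qed.

Fact Picard_mulA : associative Picard_mul.
Proof.
move=> g h k; rewrite -(Picard_classK g) -(Picard_classK h) -(Picard_classK k).
by rewrite !Picard_classM mulgA.
Qed.
Fact Picard_mul1g : left_id Picard_one Picard_mul.
Proof. by move=> g; rewrite -(Picard_classK g) Picard_classM mul1g. Qed.
Fact Picard_mulg1 : right_id Picard_one Picard_mul.
Proof. by move=> g; rewrite -(Picard_classK g) Picard_classM mulg1. Qed.
Fact Picard_mulVg : left_inverse Picard_one Picard_inv Picard_mul.
Proof. by move=> g; rewrite -{2}(Picard_classK g) Picard_classM mulVg. Qed.
Fact Picard_mulgV : right_inverse Picard_one Picard_inv Picard_mul.
Proof. by move=> g; rewrite -{1}(Picard_classK g) Picard_classM mulgV. Qed.

HB.instance Definition _ := isGroup.Build Picard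
  Picard_mulA Picard_mul1g Picard_mulg1 Picard_mulVg Picard_mulgV.

(* [None] is the point at infinity of Q(i, sqrt 3) U {oo}.                    *)
Definition mobius (F : fieldType) (M : 'M[F]_2) (x : option F) : option F :=
  match x with
  | Some z =>
      let d := M 1 0 * z + M 1 1 in
      if d == 0 then None else Some ((M 0 0 * z + M 0 1) / d)
  | None => if M 1 0 == 0 then None else Some (M 0 0 / M 1 0)
  end.

Definition Picard_act (g : Picard) (x : option Qi3) : option Qi3 :=
  mobius (repr g) x.

Lemma mobiusN (F : fieldType) (M : 'M[F]_2) : mobius (- M) =1 mobius M.
Proof.
case=> [z|] /=; rewrite !mxE; last by rewrite oppr_eq0 invrN mulrNN.
by rewrite !mulNr -!opprD oppr_eq0 invrN mulrNN.
Qed.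

Lemma Picard_actE (M : SL2) : Picard_act (Picard_class M) =1 mobius M.
Proof.
by move=> x; rewrite /Picard_act; case: (repr_class M) => ->; rewrite ?mobiusN.
Qed.

Lemma mobius1 (F : fieldType) : mobius (1%:M : 'M[F]_2) =1 id.
Proof.
case=> [z|] /=; rewrite !mxE /= ?eqxx //.
by rewrite !mul0r add0r mul1r addr0 oner_eq0 divr1.
Qed.

Lemma Picard_act1 : Picard_act 1%g =1 id.
Proof. by move=> x; rewrite Picard_actE mobius1. Qed.

Lemma mobiusM (F : fieldType) (M N : 'M[F]_2) :
  \det N != 0 -> mobius (M *m N) =1 mobius M \o mobius N.
Proof.
have E i j : (M *m N) i j = M i 0 * N 0 j + M i 1 * N 1 j.
  rewrite mxE !big_ord_recl big_ord0 addr0.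
  by rewrite (_ : lift _ _ = 1) //; apply: val_inj.
have -> : \det N = N 0 0 * N 1 1 - N 0 1 * N 1 0.
  rewrite (expand_det_row _ 0) !big_ord_recl big_ord0 /cofactor.
  rewrite !det_mx11 !mxE /= (_ : lift 0 0 = 1); last exact: val_inj.
  rewrite (_ : lift 1 0 = 0); last exact: val_inj.
  by rewrite addr0 expr0 expr1 mul1r mulN1r mulrN.
move=> detN; case=> [z|] /=; rewrite !E.
- set u := N 0 0 * z + N 0 1; set d := N 1 0 * z + N 1 1.
  have L i : (M i 0 * N 0 0 + M i 1 * N 1 0) * z
             + (M i 0 * N 0 1 + M i 1 * N 1 1) = M i 0 * u + M i 1 * d.
    by rewrite /u /d; ring.
  rewrite !L; have [d0|d0] /= := eqVneq d 0; last first.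
    have L' i : M i 0 * u + M i 1 * d = (M i 0 * (u / d) + M i 1) * d.
      by rewrite mulrDl -mulrA divfK.
    by rewrite !L' mulf_eq0 (negbTE d0) orbF -mulf_div divff // mulr1.
  have u0 : u != 0.
    apply: contraNneq detN => u0.
    have D : (N 0 0 * N 1 1 - N 0 1 * N 1 0) = N 0 0 * d - N 1 0 * u.
      by rewrite /u /d; ring.
    by rewrite D d0 u0 !mulr0 subrr.
  by rewrite d0 !mulr0 !addr0 mulf_eq0 (negbTE u0) orbF -mulf_div divff // mulr1.
- have [c0|c0] /= := eqVneq (N 1 0) 0.
    have a0 : N 0 0 != 0.
      by apply: contraNneq detN => a0; rewrite a0 c0 mul0r mulr0 subrr.
    rewrite c0 !mulr0 !addr0 mulf_eq0 (negbTE a0) orbF.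
    by rewrite -mulf_div divff // mulr1.
  have L i : M i 0 * N 0 0 + M i 1 * N 1 0
             = (M i 0 * (N 0 0 / N 1 0) + M i 1) * N 1 0.
    by rewrite mulrDl -mulrA divfK.
  by rewrite !L mulf_eq0 (negbTE c0) orbF -mulf_div divff // mulr1.
Qed.

Lemma Picard_actM (g h : Picard) (x : option Qi3) :
  Picard_act (g * h)%g x = Picard_act g (Picard_act h x).
Proof.
rewrite -(Picard_classK g) -(Picard_classK h).
rewrite [(_ * _)%g]Picard_classM !Picard_actE; apply: mobiusM.
by have /andP[_ /eqP ->] := valP (repr h); rewrite oner_eq0.
Qed.

Definition Picard_orbit (x : option Qi3) : set (option Qi3) :=
  [set Picard_act g x | g in [set: Picard]]%classic.

(* (a + b sqrt 3) / c; its conjugate is qirr a (- b) c.                       *)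
Definition qirr (a b c : int) : Qi3 :=
  (a%:~R + b%:~R * sqrt3) / c%:~R.

(* For a real quadratic number these are reals, compared in algC.            *)
Definition opposite_signs (x y : Qi3) : Prop :=
  (Qi3toC x < 0 /\ 0 < Qi3toC y) \/ (0 < Qi3toC x /\ Qi3toC y < 0).

(* [1%VS] is the prime field Q, so [z] is required to be irrational.          *)
Definition ambiguous (z : Qi3) : Prop :=
  exists a b c : int,
    [/\ c != 0, z = qirr a b c, z \notin 1%VS
      & opposite_signs (qirr a b c) (qirr a (- b) c)].

(* Main.v *)
Require Import Defs.
From mathcomp Require Import all_boot all_order all_algebra all_field.
From mathcomp Require Import boolp classical_sets cardinality.
From mathcomp Require Import ring zify.
Local Open Scope classical_set_scope.

(** The proof goes through binary quadratic forms. The ambiguous number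
    alpha = (x + y sqrt 3) / w is a root of the integral quadratic polynomial
    w^2 X^2 - 2 x w X + (x^2 - 3 y^2), whose discriminant D = 12 y^2 w^2 is a
    positive integer. If beta = g alpha with g in SL(2, Z[i]), then
    transporting this polynomial along g gives A X^2 + B X + C with
    coefficients in Z[i], root beta and the same discriminant D
    ([mobius_root_transport]).

    Suppose beta is itself ambiguous. It is real and irrational, so 1 and beta
    are linearly independent over Q(i) ([real_irrational_free]), and
    (A, B, C) must be proportional to the integral triple attached to beta.
    The ratio lies in Q(i) and its square is the quotient of two positive
    discriminants, so it is real: A, B and C are ordinary integers. As beta and
    its conjugate have opposite signs, A C < 0 ([ambiguous_root_coefs]).
    Hence D = B^2 + 4 |A C| bounds |A| and |B|. Finally
    (2 A beta + B)^2 = D, so beta is determined by A, B and the choice of one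
    of the two square roots of D, which leaves finitely many possibilities. *)

Set Implicit Arguments.
Unset Strict Implicit.
Unset Printing Implicit Defensive.

Import Order.TTheory GRing.Theory Num.Theory.
Local Open Scope ring_scope.

(** * Identities for quadratic polynomials over a field *)

Section QuadraticIdentities.

Variable F : fieldType.
Implicit Types A B C p q r s t x y w z : F.

Lemma quad_norm x y w t : w != 0 ->
  w ^+ 2 * ((x + y * t) / w * ((x + - y * t) / w))
  = x ^+ 2 - t ^+ 2 * y ^+ 2.
Proof. by move=> w0; field. Qed.

Lemma quad_root x y w t : w != 0 ->
  w ^+ 2 * ((x + y * t) / w) ^+ 2 + - (2 * x * w) * ((x + y * t) / w)
  + (x ^+ 2 - t ^+ 2 * y ^+ 2) = 0.
Proof. by move=> w0; field. Qed.

Lemma quad_disc x y w t :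
  (- (2 * x * w)) ^+ 2 - 4 * w ^+ 2 * (x ^+ 2 - t ^+ 2 * y ^+ 2)
  = (2 * y * w * t) ^+ 2.
Proof. ring. Qed.

(** Eliminating the quadratic term between two polynomials with the common
    root z leaves a linear relation on z. *)
Lemma common_root_elim A B C A' B' C' z :
  A * z ^+ 2 + B * z + C = 0 -> A' * z ^+ 2 + B' * z + C' = 0 ->
  (A * B' - A' * B) * z + (A * C' - A' * C) = 0.
Proof.
move=> E E'; transitivity (A * (A' * z ^+ 2 + B' * z + C')
                           - A' * (A * z ^+ 2 + B * z + C)); first by ring.
by rewrite E E' !mulr0 subrr.
Qed.

Lemma proportional_disc A B C A' B' C' :
  A * B' = A' * B -> A * C' = A' * C ->
  A ^+ 2 * (B' ^+ 2 - 4 * A' * C') = A' ^+ 2 * (B ^+ 2 - 4 * A * C).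
Proof.
move=> EB EC; transitivity ((A * B') ^+ 2 - 4 * A * A' * (A * C')).
  by ring.
by rewrite EB EC; ring.
Qed.

Lemma root_transport A B C p q r s z : r * z + s != 0 ->
  (A * s ^+ 2 - B * r * s + C * r ^+ 2) * ((p * z + q) / (r * z + s)) ^+ 2
  + (B * (p * s + q * r) - 2 * A * q * s - 2 * C * p * r)
    * ((p * z + q) / (r * z + s))
  + (A * q ^+ 2 - B * p * q + C * p ^+ 2)
  = (p * s - q * r) ^+ 2 * (A * z ^+ 2 + B * z + C) / (r * z + s) ^+ 2.
Proof. by move=> d0; field. Qed.

Lemma disc_transport A B C p q r s :
  (B * (p * s + q * r) - 2 * A * q * s - 2 * C * p * r) ^+ 2
  - 4 * (A * s ^+ 2 - B * r * s + C * r ^+ 2)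
      * (A * q ^+ 2 - B * p * q + C * p ^+ 2)
  = (p * s - q * r) ^+ 2 * (B ^+ 2 - 4 * A * C).
Proof. ring. Qed.

Lemma complete_square A B C z : A * z ^+ 2 + B * z + C = 0 ->
  (2 * A * z + B) ^+ 2 = B ^+ 2 - 4 * A * C.
Proof.
move=> E; apply/eqP; rewrite -subr_eq0; apply/eqP.
by transitivity (4 * A * (A * z ^+ 2 + B * z + C));
  [ring | rewrite E mulr0].
Qed.

End QuadraticIdentities.

(** * Integers and Gaussian integers in Q(i, sqrt 3) *)

Lemma sqrt3_sqr : sqrt3 ^+ 2 = 3.
Proof.
apply: (fmorph_inj Qi3toC).
by rewrite rmorphXn /= Qi3toC_sqrt3 sqrtCK rmorph_nat.
Qed.

Lemma Qi3_intr_inj : injective (fun m : int => m%:~R : Qi3).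
Proof.
move=> m n /= /(congr1 Qi3toC); rewrite !rmorph_int => /eqP.
by rewrite eqr_int => /eqP.
Qed.

Lemma Qi3_intr_eq0 (m : int) : ((m%:~R : Qi3) == 0) = (m == 0).
Proof. by rewrite -[0]/(0%:~R) (inj_eq Qi3_intr_inj). Qed.

Lemma Qi3_intr_disc (a b c : int) :
  (b ^+ 2 - 4 * a * c)%:~R = b%:~R ^+ 2 - 4 * a%:~R * c%:~R :> Qi3.
Proof. by rewrite !(rmorphB, rmorphM, rmorphXn). Qed.

Lemma gaussInt_int (m : int) : m%:~R \in gaussInt.
Proof. exact: rpred_int. Qed.

Lemma real_gaussInt (z : Qi3) :
  z \in gaussInt -> Qi3toC z \is Num.real -> exists m : int, z = m%:~R.
Proof.
move=> /andP[/intrP[m Dm] _] /Creal_ReP zr; exists m.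
by apply: (fmorph_inj Qi3toC); rewrite rmorph_int -Dm zr.
Qed.

Lemma Qi3_real_cancel (m : int) (z : Qi3) :
  m != 0 -> Qi3toC (m%:~R * z) \is Num.real -> Qi3toC z \is Num.real.
Proof.
move=> m0; rewrite rmorphM rmorph_int => mzr.
have m0' : m%:~R != 0 :> algC by rewrite intr_eq0.
by rewrite -(mulKf m0' (Qi3toC z)) rpredM // rpredV realz.
Qed.

Lemma irrational_free (m n : int) (z : Qi3) :
  z \notin 1%VS -> m%:~R * z + n%:~R = 0 -> m = 0.
Proof.
move=> zQ E; apply/eqP; apply: contraNT zQ => m0.
have m0' : m%:~R != 0 :> Qi3 by rewrite Qi3_intr_eq0.
have -> : z = - n%:~R / m%:~R.
  apply: (mulfI m0'); rewrite mulrCA divff // mulr1.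
  by apply/eqP; rewrite -addr_eq0 E.
by apply: (@rpred_div _ (1%AS : {subfield Qi3})); rewrite ?rpredN ?rpred_int.
Qed.

(** Since z is real, the real and imaginary parts of a linear relation over
    Z[i] are two linear relations over Z, each of which must be trivial. *)
Lemma real_irrational_free (u v z : Qi3) :
  u \in gaussInt -> v \in gaussInt -> Qi3toC z \is Num.real ->
  z \notin 1%VS -> u * z + v = 0 -> u = 0.
Proof.
move=> /andP[/intrP[m1 Dm1] /intrP[m2 Dm2]].
move=> /andP[/intrP[n1 Dn1] /intrP[n2 Dn2]] zr zQ.
move=> /(congr1 Qi3toC); rewrite rmorphD rmorphM rmorph0 /= => E.
have Ere : m1%:~R * z + n1%:~R = 0.
  apply: (fmorph_inj Qi3toC); rewrite rmorphD rmorphM !rmorph_int rmorph0 /=.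
  by rewrite -Dm1 -Dn1 -ReMr // -raddfD E raddf0.
have Eim : m2%:~R * z + n2%:~R = 0.
  apply: (fmorph_inj Qi3toC); rewrite rmorphD rmorphM !rmorph_int rmorph0 /=.
  by rewrite -Dm2 -Dn2 -ImMr // -raddfD E raddf0.
apply: (fmorph_inj Qi3toC); rewrite rmorph0 [LHS]Crect Dm1 Dm2.
by rewrite (irrational_free zQ Ere) (irrational_free zQ Eim) mulr0 addr0.
Qed.

(** * Ambiguous numbers as roots of quadratic polynomials *)

Lemma ambiguous_real (z : Qi3) : ambiguous z -> Qi3toC z \is Num.real.
Proof.
by move=> [a [b [c [_ -> _ [[h _]|[h _]]]]]];
  [exact: ltr0_real | exact: gtr0_real].
Qed.

Lemma qirr_root (x y w : int) : w != 0 ->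
  (w ^+ 2)%:~R * qirr x y w ^+ 2 + (- (2 * x * w))%:~R * qirr x y w
  + (x ^+ 2 - 3 * y ^+ 2)%:~R = 0.
Proof.
move=> w0; have w0' : w%:~R != 0 :> Qi3 by rewrite Qi3_intr_eq0.
rewrite !(rmorphB, rmorphN, rmorphM, rmorphXn) /=.
by rewrite -[3%:~R]/(3 : Qi3) -sqrt3_sqr; apply: quad_root.
Qed.

Lemma qirr_norm_lt0 (x y w : int) :
  w != 0 -> opposite_signs (qirr x y w) (qirr x (- y) w) ->
  x ^+ 2 - 3 * y ^+ 2 < 0.
Proof.
move=> w0 opp; have w0' : w%:~R != 0 :> Qi3 by rewrite Qi3_intr_eq0.
have E : (w ^+ 2)%:~R * (qirr x y w * qirr x (- y) w)
         = (x ^+ 2 - 3 * y ^+ 2)%:~R :> Qi3.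
  rewrite !(rmorphB, rmorphM, rmorphXn) /= -[3%:~R]/(3 : Qi3) -sqrt3_sqr.
  by rewrite /qirr rmorphN /=; apply: quad_norm.
have /(congr1 Qi3toC) := E; rewrite rmorph_int => E'.
rewrite -(@ltrz0 algC) -E' rmorphM rmorph_int rmorphM /=.
rewrite pmulr_rlt0 ?ltr0z ?exprn_even_gt0 //.
by case: opp => -[h1 h2]; [rewrite nmulr_rlt0 | rewrite pmulr_rlt0].
Qed.

(** The coefficients are lambda times those of [qirr_root] for some lambda in
    Q(i). Comparing discriminants shows that the square of lambda is positive,
    so lambda is real; and A C has the sign of the product of the roots. *)
Lemma ambiguous_root_coefs (D : int) (A B C z : Qi3) :
  0 < D -> ambiguous z ->
  A \in gaussInt -> B \in gaussInt -> C \in gaussInt ->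
  A * z ^+ 2 + B * z + C = 0 -> B ^+ 2 - 4 * A * C = D%:~R ->
  exists a b c : int,
    [/\ A = a%:~R, B = b%:~R, a * c < 0 & b ^+ 2 - 4 * a * c = D].
Proof.
move=> D0 amb ZA ZB ZC Ez ED; have zr := ambiguous_real amb.
have [x [y [w [w0 Dz zQ opp]]]] := amb.
have n0 := qirr_norm_lt0 w0 opp; have := qirr_root x y w0; rewrite -Dz.
set k := w ^+ 2; set l := - _; set n := x ^+ 2 - _ in n0 *.
have k0 : 0 < k by rewrite exprn_even_gt0.
have kN0 : k != 0 by rewrite gt_eqF.
have disc_gt0 : 0 < l ^+ 2 - 4 * k * n.
  rewrite subr_gt0; apply: (@lt_le_trans _ _ 0); last exact: exprn_even_ge0.
  by rewrite pmulr_rlt0 // mulr_gt0.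
move=> /common_root_elim /(_ Ez) E; clearbody k l n.
have Zi := gaussInt_int.
have EB : k%:~R * B = A * l%:~R.
  apply/eqP; rewrite -subr_eq0.
  by apply/eqP/(real_irrational_free _ _ zr zQ E); rewrite rpredB ?rpredM.
have EC : k%:~R * C = A * n%:~R.
  move: E; rewrite EB subrr mul0r add0r => /eqP.
  by rewrite subr_eq0 => /eqP.
have Ri (m : int) : Qi3toC m%:~R \is Num.real by rewrite rmorph_int realz.
have Ar : Qi3toC A \is Num.real.
  have := proportional_disc EB EC; rewrite ED => /(congr1 Qi3toC).
  rewrite -Qi3_intr_disc !(rmorphM, rmorphXn) /= !rmorph_int => EA.
  rewrite realEsqr -(@pmulr_lge0 _ (l ^+ 2 - 4 * k * n)%:~R) ?ltr0z // -EA.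
  by rewrite mulr_ge0 ?ler0z ?(ltW D0) // -realEsqr realz.
have Br : Qi3toC B \is Num.real.
  by apply: (Qi3_real_cancel kN0); rewrite EB rmorphM rpredM.
have Cr : Qi3toC C \is Num.real.
  by apply: (Qi3_real_cancel kN0); rewrite EC rmorphM rpredM.
have [a Da] := real_gaussInt ZA Ar; have [b Db] := real_gaussInt ZB Br.
have [c Dc] := real_gaussInt ZC Cr; exists a, b, c.
have HD : b ^+ 2 - 4 * a * c = D.
  by apply: Qi3_intr_inj; rewrite /= Qi3_intr_disc -ED Da Db Dc.
have Hb : k * b = a * l.
  by apply: Qi3_intr_inj; rewrite /= !rmorphM /= -Da -Db EB.
have Hc : k * c = a * n.
  by apply: Qi3_intr_inj; rewrite /= !rmorphM /= -Da -Dc EC.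
have a0 : a != 0.
  apply: contraTneq D0 => a0; move: Hb; rewrite a0 mul0r => /eqP.
  rewrite mulf_eq0 (negPf kN0) /= => /eqP b0.
  by rewrite -HD a0 b0 mulr0 mul0r subrr ltxx.
split=> //; rewrite -(pmulr_rlt0 _ k0) mulrCA Hc mulrA -expr2.
by rewrite pmulr_rlt0 // exprn_even_gt0.
Qed.

Lemma det_mx2 (R : comNzRingType) (M : 'M[R]_2) :
  \det M = M 0 0 * M 1 1 - M 0 1 * M 1 0.
Proof.
rewrite (expand_det_row _ 0) !big_ord_recl big_ord0 /cofactor.
rewrite !det_mx11 !mxE /= (_ : lift 0 0 = 1); last exact: val_inj.
rewrite (_ : lift 1 0 = 0); last exact: val_inj.
by rewrite addr0 expr0 expr1 mul1r mulN1r mulrN.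
Qed.

(** The new polynomial is the old one composed with the inverse Moebius map,
    cleared of denominators; it has the same discriminant because M has
    determinant 1. *)
Lemma mobius_root_transport (A B C : Qi3) (M : 'M[Qi3]_2) (z t : Qi3) :
  A \in gaussInt -> B \in gaussInt -> C \in gaussInt -> inSL2 M ->
  A * z ^+ 2 + B * z + C = 0 -> mobius M (Some z) = Some t ->
  exists A' B' C' : Qi3,
    [/\ [/\ A' \in gaussInt, B' \in gaussInt & C' \in gaussInt],
        A' * t ^+ 2 + B' * t + C' = 0
      & B' ^+ 2 - 4 * A' * C' = B ^+ 2 - 4 * A * C].
Proof.
move=> ZA ZB ZC /andP[/mxOverP ZM /eqP]; rewrite det_mx2 => detM Ez /=.
move: (ZM 0 0) (ZM 0 1) (ZM 1 0) (ZM 1 1) detM.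
set p := M 0 0; set q := M 0 1; set r := M 1 0; set s := M 1 1.
move=> Zp Zq Zr Zs detM; case: eqVneq => // d0 [Dt].
exists (A * s ^+ 2 - B * r * s + C * r ^+ 2).
exists (B * (p * s + q * r) - 2 * A * q * s - 2 * C * p * r).
exists (A * q ^+ 2 - B * p * q + C * p ^+ 2); split.
- by split; rewrite !(rpred1, rpredD, rpredN, rpredM, rpredX).
- by rewrite -Dt root_transport // Ez mulr0 mul0r.
- by rewrite disc_transport detM expr1n mul1r.
Qed.

(** * Finiteness *)

Lemma indefinite_coef_bound (a b c : int) : a * c < 0 ->
  `|a| <= b ^+ 2 - 4 * a * c /\ `|b| <= b ^+ 2 - 4 * a * c.
Proof.
move=> ac; have b2 : `|b| <= b ^+ 2.
  by case: (b =P 0) => [-> //|b0]; nia.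
have : `|a| <= - (a * c).
  have [a0|a0] := ltP 0 a; last by have c0 : 0 < c; nia.
  by have c0 : c < 0; nia.
by split; nia.
Qed.

Lemma finite_bounded_int (N : int) : finite_set [set m : int | `|m| <= N].
Proof.
apply: (@sub_finite_set _ _
  ((fun k : nat => k%:Z - N) @` `I_(absz N + absz N).+1)).
  by move=> m /= h; exists (absz (m + N)); lia.
exact/finite_image/finite_II.
Qed.

Theorem lemma3 (alpha : Qi3) (alphaP : ambiguous alpha) :
  finite_set [set beta : Qi3 |
    Picard_orbit (Some alpha) (Some beta) /\ ambiguous beta].
Proof.
have [x [y [w [w0 Da aQ opp]]]] := alphaP.
have y0 : y != 0.
  by apply: contraTneq (qirr_norm_lt0 w0 opp) => ->; rewrite -leNgt; nia.
have := qirr_root x y w0; rewrite -Da.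
set k := w ^+ 2; set l := - _; set n := x ^+ 2 - _ => Ea.
pose D : int := l ^+ 2 - 4 * k * n.
pose sqrtD : Qi3 := 2 * y%:~R * w%:~R * sqrt3.
have D0 : 0 < D.
  have -> : D = 12 * (y * w) ^+ 2 by rewrite /D /k /l /n; ring.
  by rewrite pmulr_rgt0 // exprn_even_gt0 //= mulf_neq0.
have DE : l%:~R ^+ 2 - 4 * k%:~R * n%:~R = D%:~R :> Qi3.
  by rewrite /D Qi3_intr_disc.
have sqrtDE : sqrtD ^+ 2 = D%:~R.
  rewrite -DE /k /l /n !(rmorphB, rmorphN, rmorphM, rmorphXn) /=.
  by rewrite -[3%:~R]/(3 : Qi3) -sqrt3_sqr; apply/esym/quad_disc.
pose I : set int := [set m | `|m| <= D].
(* The quadratic formula, with the sign of the square root as a boolean. *)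
pose f (abe : int * int * bool) : Qi3 :=
  ((-1) ^+ abe.2 * sqrtD - abe.1.2%:~R) / (2 * abe.1.1%:~R).
apply: (@sub_finite_set _ _ (f @` (I `*` I `*` setT))); last first.
  apply/finite_image/finite_setX; last exact: finite_finset.
  by apply: finite_setX; apply: finite_bounded_int.
move=> beta [[g _ Eg] betaP].
have [A [B [C [[ZA ZB ZC] Eb Ed]]]] := mobius_root_transport
  (gaussInt_int _) (gaussInt_int _) (gaussInt_int _) (valP (repr g)) Ea Eg.
rewrite DE in Ed.
have [a [b [c [DA DB ac Dabc]]]] :=
  ambiguous_root_coefs D0 betaP ZA ZB ZC Eb Ed.
have [ha hb] := indefinite_coef_bound b ac; rewrite Dabc in ha hb.
have a0 : 2 * a%:~R != 0 :> Qi3.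
  rewrite -[2]/(2%:~R) -rmorphM Qi3_intr_eq0 mulf_eq0 /=.
  by apply: contraTneq ac => ->; rewrite mul0r ltxx.
have : (2 * A * beta + B) ^+ 2 == sqrtD ^+ 2.
  by rewrite (complete_square Eb) Ed sqrtDE.
rewrite eqf_sqr DA DB => sq.
exists (a, b, 2 * a%:~R * beta + b%:~R != sqrtD); first by [].
rewrite /f /=; set e := _ * sqrtD.
have -> : e = 2 * a%:~R * beta + b%:~R.
  rewrite /e; case: eqP sq => [-> _|_ /= /eqP ->].
    by rewrite expr0 mul1r.
  by rewrite expr1 mulN1r.
by rewrite addrK mulrAC divff // mul1r.
Qed.
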